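(* Let $X=\sum_{k=0}^7 x_k g_k\in\mathbb{R}^8$ (with $x_k\in\mathbb{R}$), let $X_0,\ldots,X_7\in\mathbb{R}^8$ be the twistor vectors of $X$, and let $Z_0,\ldots,Z_7\in\mathbb{O}\otimes C\ell_8$ be the Hermitian variables of $X$. Then for every $i=0,1,\ldots,7$, the following identities hold in $\mathbb{O}\otimes C\ell_8$: $$X_i=\frac{1}{8}\,\mathbf{e}_i\sum_{j=0}^7(-1)^{\sigma(j,i)}Z_j,\qquad Z_i=\sum_{j=0}^7 J_i(\mathbf{e}_j)X_j,$$ where in the first formula $\mathbf{e}_i$ multiplies the whole sum from the left.
   Context: Octonions: $\mathbb{O}$ is the (non-associative) real octonion algebra with basis $\mathbf{e}_0=1,\mathbf{e}_1,\ldots,\mathbf{e}_7$, where $\mathbf{e}_i\mathbf{e}_j+\mathbf{e}_j\mathbf{e}_i=-2\delta_{ij}$ for $1\le i,j\le 7$, and $\mathbf{e}_i\mathbf{e}_j=\mathbf{e}_k$ whenever $(i,j,k)$ is a cyclic permutation of one of $(1,2,3),(1,4,5),(1,7,6),(2,5,7),(2,4,6),(3,4,7),(3,6,5)$. Conjugation is $\overline{x_0+\sum_{i\ge1}x_i\mathbf{e}_i}=x_0-\sum_{i\ge1}x_i\mathbf{e}_i$ for real $x_i$. Clifford algebra: $\mathbb{R}^8$ has orthonormal basis $g_0,\ldots,g_7$; $C\ell_8$ is the associative unital real Clifford algebra generated by $g_0,\ldots,g_7$ with $g_ig_j+g_jg_i=-2\delta_{ij}$, and $\mathbb{R}^8\subset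 C\ell_8$. The real tensor product algebra $\mathbb{O}\otimes C\ell_8$ has the product $(a\otimes u)(b\otimes v)=(ab)\otimes(uv)$; the tensor sign is omitted, and $\mathbb{O}$ and $C\ell_8$ are regarded as subalgebras via $a\mapsto a\otimes1$, $u\mapsto 1\otimes u$. Involutions: for $i\in\{0,\ldots,7\}$ write $i=4i_3+2i_2+i_1$ with $i_1,i_2,i_3\in\{0,1\}$. $J_i$ is the algebra automorphism of $\mathbb{O}$ determined by $J_i(\mathbf{e}_1)=(-1)^{i_1}\mathbf{e}_1$, $J_i(\mathbf{e}_2)=(-1)^{i_2}\mathbf{e}_2$, $J_i(\mathbf{e}_4)=(-1)^{i_3}\mathbf{e}_4$ (these elements generate $\mathbb{O}$). It is extended real-linearly to $\mathbb{O}\otimes C\ell_8$ by $J_i(a\otimes u)=J_i(a)\otimes u$. The signs $\sigma(j,i)\in\{0,1\}$ are defined by $J_j(\overline{\mathbf{e}_i})=(-1)^{\sigma(j,i)}\mathbf{e}_i$ for $i,j=0,\ldots,7$. Further definitions: $\Phi:\mathbb{R}^8\to\mathbb{O}$ is the linear isomorphism $\Phi(\sum_i x_ig_i)=\sum_i x_i\mathbf{e}_i$. Put $\Omega=\sum_{i=0}^7\overline{\mathbf{e}_i}\,g_i\in\mathbb{O}\otimes C\ell_8$ and $f_i=J_i(\Omega)$ (the octonionic Witt basis). For $X\in\mathbb{R}^8$ and $i=0,\ldots,7$, the twistor vectors are $X_i=\Phi^{-1}(\Phi(X)\overline{\mathbf{e}_i})\in\mathbb{R}^8$, and the Hermitian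 variables are $Z_i=f_iJ_i(\Phi(X))=J_i(\Omega\,\Phi(X))\in\mathbb{O}\otimes C\ell_8$. *)

(* Defs.v *)
From HB Require Import structures.
From mathcomp Require Import all_boot all_order all_algebra.
From mathcomp Require Import reals.

Set Implicit Arguments.
Unset Strict Implicit.
Unset Printing Implicit Defensive.

Import Order.TTheory GRing.Theory Num.Theory.
Local Open Scope ring_scope.

(** An element of the Clifford algebra is the family of its coordinates in the
    basis (e_A), where e_A = g_(a_1) * ... * g_(a_k) for A = {a_1 < ... < a_k}.
    The algebra satisfies g_i g_j + g_j g_i = - 2 delta_ij ([cliff_genP]), the
    e_A are those products ([cliff_basisE]), and they span ([cliff_decomp]);
    being of dimension 2 ^ n, it is the algebra presented by these
    relations. *)

Definition symdiff (T : finType) (A B : {set T}) : {set T} :=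
  (A :\: B) :|: (B :\: A).

(* Bringing e_A * e_B into order takes one sign for each pair a > b, and each
   a = b contributes another one through g_a ^+ 2 = - 1. *)
Definition cliff_inv (n : nat) (A B : {set 'I_n}) : nat :=
  \sum_(a in A) \sum_(b in B) (b <= a)%N.

Definition clifford (R : pzRingType) (n : nat) : Type :=
  {ffun {set 'I_n} -> R}.

HB.instance Definition _ (R : pzRingType) (n : nat) :=
  GRing.Lmodule.copy (clifford R n) {ffun {set 'I_n} -> R^o}.

Definition cliff_basis (R : pzRingType) (n : nat) (A : {set 'I_n}) :
  clifford R n := [ffun B => (B == A)%:R].

Definition cliff_gen (R : pzRingType) (n : nat) (i : 'I_n) : clifford R n :=
  cliff_basis R [set i].

Definition cliff_mul (R : pzRingType) (n : nat) (u v : clifford R n) :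
  clifford R n :=
  \sum_(A : {set 'I_n}) \sum_(B : {set 'I_n})
    ((-1) ^+ cliff_inv A B * (u A * v B)) *: cliff_basis R (symdiff A B).

Section CliffordRing.
Variables (R : comNzRingType) (n : nat).
Implicit Types (A B C : {set 'I_n}) (u v w : clifford R n) (c : R).
Local Notation e := (@cliff_basis R n).
Local Notation mul := (@cliff_mul R n).

Lemma in_symdiff A B x : (x \in symdiff A B) = (x \in A) (+) (x \in B).
Proof. by rewrite !inE; case: (x \in A); case: (x \in B). Qed.

Lemma symdiffA A B C :
  symdiff A (symdiff B C) = symdiff (symdiff A B) C.
Proof. by apply/setP=> x; rewrite !in_symdiff addbA. Qed.

Lemma symdiff0s A : symdiff set0 A = A.
Proof. by apply/setP=> x; rewrite in_symdiff inE. Qed.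

Lemma symdiffs0 A : symdiff A set0 = A.
Proof. by apply/setP=> x; rewrite in_symdiff inE addbF. Qed.

Lemma sum_symdiff A B (f : 'I_n -> nat) :
  (\sum_(a in symdiff A B) f a + (\sum_(a in A :&: B) f a).*2 =
   \sum_(a in A) f a + \sum_(a in B) f a)%N.
Proof.
rewrite -addnn ![(\sum_(a in _) _)%N]big_mkcond -!big_split /=.
apply: eq_bigr => a _; rewrite in_symdiff inE.
by case: (a \in A); case: (a \in B); rewrite /= ?addn0 ?add0n.
Qed.

Lemma cliff_invC A B :
  cliff_inv A B = (\sum_(b in B) \sum_(a in A) (b <= a)%N)%N.
Proof. exact: exchange_big. Qed.

Lemma sign_symdiffl A B C :
  (-1) ^+ cliff_inv (symdiff A B) C =
  (-1) ^+ cliff_inv A C * (-1) ^+ cliff_inv B C :> R.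
Proof.
rewrite -exprD /cliff_inv -sum_symdiff exprD.
by rewrite -[X in _ = _ * X]signr_odd odd_double mulr1.
Qed.

Lemma sign_symdiffr A B C :
  (-1) ^+ cliff_inv A (symdiff B C) =
  (-1) ^+ cliff_inv A B * (-1) ^+ cliff_inv A C :> R.
Proof.
rewrite -exprD !cliff_invC -sum_symdiff exprD.
by rewrite -[X in _ = _ * X]signr_odd odd_double mulr1.
Qed.

Lemma cliffZE c u A : (c *: u) A = c * u A.
Proof. by rewrite ffunE. Qed.

Lemma cliff_expand u : u = \sum_A u A *: e A.
Proof.
apply/ffunP=> B; rewrite sum_ffunE (bigD1 B) //= big1 ?addr0.
  by rewrite cliffZE ffunE eqxx mulr1.
by move=> A nAB; rewrite cliffZE ffunE eq_sym (negPf nAB) mulr0.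
Qed.

Lemma cliff_mulDl : left_distributive mul +%R.
Proof.
move=> u v w; rewrite -big_split; apply: eq_bigr => A _ /=.
rewrite -big_split; apply: eq_bigr => B _ /=.
by rewrite ffunE mulrDl mulrDr scalerDl.
Qed.

Lemma cliff_mulDr : right_distributive mul +%R.
Proof.
move=> u v w; rewrite -big_split; apply: eq_bigr => A _ /=.
rewrite -big_split; apply: eq_bigr => B _ /=.
by rewrite ffunE !mulrDr scalerDl.
Qed.

Lemma cliff_mulZl c u v : mul (c *: u) v = c *: mul u v.
Proof.
rewrite scaler_sumr; apply: eq_bigr => A _; rewrite scaler_sumr.
apply: eq_bigr => B _.
by rewrite cliffZE scalerA -mulrA mulrCA.
Qed.

Lemma cliff_mulZr c u v : mul u (c *: v) = c *: mul u v.
Proof.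
rewrite scaler_sumr; apply: eq_bigr => A _; rewrite scaler_sumr.
apply: eq_bigr => B _.
by rewrite cliffZE scalerA (mulrCA (u A)) (mulrCA _ c).
Qed.

Lemma cliff_mul0l v : mul 0 v = 0.
Proof. by rewrite -[X in mul X](scale0r 0) cliff_mulZl scale0r. Qed.

Lemma cliff_mul0r v : mul v 0 = 0.
Proof. by rewrite -[X in mul _ X](scale0r 0) cliff_mulZr scale0r. Qed.

Lemma cliff_mul_basis A B :
  mul (e A) (e B) = (-1) ^+ cliff_inv A B *: e (symdiff A B).
Proof.
rewrite /cliff_mul (bigD1 A) //= [X in _ + X]big1 => [|A' /negPf nA].
  rewrite addr0 (bigD1 B) //= [X in _ + X]big1 => [|B' /negPf nB].
    by rewrite addr0 !ffunE !eqxx !mulr1.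
  by rewrite !ffunE nB !mulr0 scale0r.
by rewrite big1 // => B' _; rewrite !ffunE nA mul0r mulr0 scale0r.
Qed.

Lemma cliff_ind (P : clifford R n -> Prop) :
  P 0 -> (forall c A u, P u -> P (c *: e A + u)) -> forall u, P u.
Proof.
move=> P0 PD u; rewrite [u]cliff_expand.
by elim/big_rec: _ => // A v _; apply: PD.
Qed.

Lemma cliff_mulA : associative mul.
Proof.
move=> u v w; elim/cliff_ind: u => [|a A u IHu].
  by rewrite !cliff_mul0l.
rewrite !cliff_mulDl {}IHu; congr (_ + _); rewrite !cliff_mulZl.
congr (_ *: _); elim/cliff_ind: v => [|b B v IHv].
  by rewrite cliff_mul0r !cliff_mul0l cliff_mul0r.
rewrite cliff_mulDr !cliff_mulDl cliff_mulDr {}IHv; congr (_ + _).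
rewrite cliff_mulZr !cliff_mulZl cliff_mulZr.
congr (_ *: _); elim/cliff_ind: w => [|c C w IHw].
  by rewrite !cliff_mul0r.
rewrite !cliff_mulDr {}IHw; congr (_ + _); rewrite !cliff_mulZr.
congr (_ *: _); rewrite !cliff_mul_basis cliff_mulZl cliff_mulZr.
rewrite !cliff_mul_basis !scalerA symdiffA sign_symdiffl sign_symdiffr.
by congr (_ *: _); rewrite mulrC -mulrA.
Qed.

Lemma cliff_inv0s A : cliff_inv set0 A = 0%N.
Proof. by rewrite /cliff_inv big_set0. Qed.

Lemma cliff_invs0 A : cliff_inv A set0 = 0%N.
Proof. by rewrite cliff_invC big_set0. Qed.

Lemma cliff_mul1l : left_id (e set0) mul.
Proof.
elim/cliff_ind=> [|c A u IHu]; first by rewrite cliff_mul0r.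
rewrite cliff_mulDr IHu cliff_mulZr.
by rewrite cliff_mul_basis cliff_inv0s symdiff0s scale1r.
Qed.

Lemma cliff_mul1r : right_id (e set0) mul.
Proof.
elim/cliff_ind=> [|c A u IHu]; first by rewrite cliff_mul0l.
rewrite cliff_mulDl IHu cliff_mulZl.
by rewrite cliff_mul_basis cliff_invs0 symdiffs0 scale1r.
Qed.

Lemma cliff_one_neq0 : e set0 != 0.
Proof.
apply/eqP=> /ffunP/(_ set0); rewrite !ffunE eqxx => /eqP.
by rewrite oner_eq0.
Qed.
End CliffordRing.

HB.instance Definition _ (R : comNzRingType) (n : nat) :=
  GRing.Zmodule_isNzRing.Build (clifford R n) (@cliff_mulA R n)
    (@cliff_mul1l R n) (@cliff_mul1r R n) (@cliff_mulDl R n)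
    (@cliff_mulDr R n) (@cliff_one_neq0 R n).

HB.instance Definition _ (R : comNzRingType) (n : nat) :=
  GRing.Lmodule_isLalgebra.Build R (clifford R n)
    (fun c u v => esym (cliff_mulZl c u v)).

HB.instance Definition _ (R : comNzRingType) (n : nat) :=
  GRing.Lalgebra_isAlgebra.Build R (clifford R n)
    (fun c u v => esym (cliff_mulZr c u v)).

Section CliffordPresentation.
Variables (R : comNzRingType) (n : nat).
Implicit Types (A B : {set 'I_n}) (u v : clifford R n).
Local Notation e := (@cliff_basis R n).
Local Notation g := (@cliff_gen R n).

Lemma cliff_basisM A B :
  e A * e B = (-1) ^+ cliff_inv A B *: e (symdiff A B).
Proof. exact: cliff_mul_basis. Qed.

Lemma cliff_genP (i j : 'I_n) :
  g i * g j + g j * g i = - (2 * (i == j)%:R)%:A.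
Proof.
rewrite /cliff_gen !cliff_basisM /cliff_inv !big_set1.
case: (ltngtP i j) => [lt_ij | lt_ji | /val_inj <-].
- rewrite -val_eqE (ltn_eqF lt_ij) mulr0 scale0r oppr0.
  rewrite scale1r scaleN1r /symdiff setUC addrC; exact: addNr.
- rewrite -val_eqE (gtn_eqF lt_ji) mulr0 scale0r oppr0.
  rewrite scale1r scaleN1r /symdiff setUC; exact: addNr.
rewrite eqxx mulr1 /symdiff setDv setU0 scaleN1r -opprD -mulr2n.
by rewrite scaler_nat.
Qed.

Lemma cliff_basisE A : e A = \prod_(i in A) g i.
Proof.
have prod_sorted (s : seq 'I_n) :
    sorted ltn (map val s) -> \prod_(i <- s) g i = e [set i in s].
  elim: s => [|i s IHs] /= s_sorted.
    by rewrite big_nil; congr e; apply/setP=> x; rewrite !inE.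
  have i_lt: {in s, forall j : 'I_n, (i < j)%N}.
    move=> j s_j; have /allP := order_path_min ltn_trans s_sorted.
    by apply; apply: map_f.
  rewrite big_cons IHs ?(path_sorted s_sorted) // cliff_basisM.
  rewrite /cliff_inv big_set1 big1 => [|j]; last first.
    by rewrite inE => /i_lt; rewrite ltnNge => /negPf->.
  rewrite scale1r; congr e; apply/setP=> x; rewrite in_symdiff !inE.
  have [-> | //] := eqVneq x i; case: (boolP (i \in s)) => // /i_lt.
  by rewrite ltnn.
rewrite -big_filter prod_sorted.
  by congr e; apply/setP=> x; rewrite inE mem_filter mem_index_enum andbT.
have: subseq (map val [seq i <- index_enum 'I_n | i \in A]) (iota 0 n).
  rewrite -val_enum_ord enumT [index_enum _]unlock.
  exact: map_subseq (filter_subseq _ _).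
by move/(subseq_sorted ltn_trans); apply; apply: iota_ltn_sorted.
Qed.

Lemma cliff_decomp u : u = \sum_A u A *: \prod_(i in A) g i.
Proof.
rewrite {1}[u]cliff_expand; apply: eq_bigr => A _; by rewrite cliff_basisE.
Qed.
End CliffordPresentation.

(* x : octo A stands for e_0 x_0 + ... + e_7 x_7.  Octonions are the case
   A = R; the general case is a model of the tensor product with A, as the
   octonions are free on e_0, ..., e_7: see [tensor_universal],
   [tensor_ext] and [tensorM]. *)
Definition octo (A : Type) : Type := {ffun 'I_8 -> A}.

Notation octonion R := (octo R^o).
Notation octoCl8 R := (octo (clifford R 8)).

Definition oct_triples : seq (seq nat) :=
  [:: [:: 1; 2; 3]; [:: 1; 4; 5]; [:: 1; 7; 6]; [:: 2; 5; 7];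
      [:: 2; 4; 6]; [:: 3; 4; 7]; [:: 3; 6; 5]]%N.

Definition oct_cyclic (i j k : nat) : bool :=
  has (fun t => [:: i; j; k] \in [:: t; rot 1 t; rot 2 t]) oct_triples.

(* The coefficient of e_k in e_i * e_j. *)
Definition oct_coef (i j k : nat) : int :=
  if i == 0%N then (j == k)%:R
  else if j == 0%N then (i == k)%:R
  else if i == j then - (k == 0%N)%:R
  else (oct_cyclic i j k)%:R - (oct_cyclic j i k)%:R.

Definition oct_mul (A : pzRingType) (x y : octo A) : octo A :=
  [ffun k : 'I_8 =>
     \sum_(i < 8) \sum_(j < 8) (x i * y j) *~ oct_coef i j k].

Notation "x *o y" := (oct_mul x y)
  (at level 40, left associativity) : ring_scope.

Definition oct_basis (R : pzRingType) (i : nat) : octonion R :=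
  [ffun j : 'I_8 => (j == i :> nat)%:R].
Arguments oct_basis R i%_N.

Definition oct_conj (R : pzRingType) (x : octonion R) : octonion R :=
  [ffun k : 'I_8 => if k == 0 then x k else - x k].

Definition oct_tensor (R : pzRingType) (A : lmodType R)
    (a : octonion R) (u : A) : octo A :=
  [ffun k : 'I_8 => (a k : R) *: u].

Definition oct_in (R : comNzRingType) (a : octonion R) : octoCl8 R :=
  oct_tensor a 1.

Definition cl8_in (R : comNzRingType) (u : clifford R 8) : octoCl8 R :=
  oct_tensor (oct_basis R 0) u.

(* The linear extension of f to the tensor product: [tensor_mapE]. *)
Definition tensor_map (R : pzRingType) (A : lmodType R)
    (f : octonion R -> octonion R) (x : octo A) : octo A :=
  \sum_(k < 8) oct_tensor (f (oct_basis R k)) (x k).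

Definition oct_automorphism (R : pzRingType)
    (J : {linear octonion R -> octonion R}) : Prop :=
  bijective J /\ (forall x y, J (x *o y) = J x *o J y).

(* The conditions determine J: [oct_involution_exists] and
   [oct_involution_unique]. *)
Definition oct_involution (R : pzRingType) (i : 'I_8)
    (J : {linear octonion R -> octonion R}) : Prop :=
  [/\ oct_automorphism J,
      J (oct_basis R 1) = (-1) ^+ odd i *: oct_basis R 1,
      J (oct_basis R 2) = (-1) ^+ odd (i %/ 2) *: oct_basis R 2 &
      J (oct_basis R 4) = (-1) ^+ odd (i %/ 4) *: oct_basis R 4].

Definition cl8_vector (R : comNzRingType) (x : 'rV[R]_8) : clifford R 8 :=
  \sum_(k < 8) x 0 k *: cliff_gen R k.

Definition oct_Phi (R : pzRingType) (x : 'rV[R]_8) : octonion R :=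
  \sum_(k < 8) x 0 k *: oct_basis R k.

Definition oct_Phi_inv (R : pzRingType) (a : octonion R) : 'rV[R]_8 :=
  \row_k a k.

Definition oct_Omega (R : comNzRingType) : octoCl8 R :=
  \sum_(i < 8) oct_tensor (oct_conj (oct_basis R i)) (cliff_gen R i).

Definition witt_basis (R : comNzRingType) (J : octonion R -> octonion R) :
  octoCl8 R := tensor_map J (oct_Omega R).

Definition twistor (R : comNzRingType) (X : 'rV[R]_8) (i : 'I_8) : 'rV[R]_8 :=
  oct_Phi_inv (oct_Phi X *o oct_conj (oct_basis R i)).

Definition hermitian_var (R : comNzRingType) (J : octonion R -> octonion R)
    (X : 'rV[R]_8) : octoCl8 R :=
  witt_basis J *o oct_in (J (oct_Phi X)).

Section OctonionFacts.
Variable R : comNzRingType.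
Local Notation oe := (oct_basis R).

Lemma octZE (A : lmodType R) c (x : octo A) k : (c *: x) k = c *: x k.
Proof. by rewrite ffunE. Qed.

Lemma oct_expand (x : octonion R) : x = \sum_(k < 8) (x k : R) *: oe k.
Proof.
apply/ffunP=> k; rewrite sum_ffunE (bigD1 k) //= big1 ?addr0.
  by rewrite octZE ffunE eqxx [RHS]mulr1.
by move=> j njk; rewrite octZE ffunE !val_eqE eq_sym (negPf njk) [LHS]mulr0.
Qed.

Lemma oct_PhiE (X : 'rV[R]_8) k : oct_Phi X k = X 0 k.
Proof.
rewrite sum_ffunE (bigD1 k) //= big1 ?addr0.
  by rewrite octZE ffunE eqxx [LHS]mulr1.
by move=> j njk; rewrite octZE ffunE !val_eqE eq_sym (negPf njk) [LHS]mulr0.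
Qed.

Lemma oct_PhiK : cancel (@oct_Phi R) (@oct_Phi_inv R).
Proof. by move=> X; apply/rowP=> k; rewrite mxE oct_PhiE. Qed.

Lemma oct_Phi_invK : cancel (@oct_Phi_inv R) (@oct_Phi R).
Proof. by move=> a; apply/ffunP=> k; rewrite oct_PhiE mxE. Qed.

Lemma oct_basisM (i j : 'I_8) :
  oe i *o oe j = \sum_(k < 8) oe k *~ oct_coef i j k.
Proof.
apply/ffunP=> k; rewrite ffunE sum_ffunE (bigD1 i) //= [X in _ + X]big1.
  rewrite addr0 (bigD1 j) //= [X in _ + X]big1 => [|j' nj]; last first.
    by rewrite !ffunE !val_eqE (negPf nj) mulr0 mul0rz.
  rewrite addr0 !ffunE !eqxx mulr1 (bigD1 k) //= big1 => [|k' nk].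
    rewrite addr0 -[oe k *~ _]scaler_int octZE ffunE eqxx.
    by rewrite [RHS]mulr1.
  rewrite -[oe k' *~ _]scaler_int octZE ffunE !val_eqE eq_sym (negPf nk).
  by rewrite [LHS]mulr0.
move=> i' ni; rewrite big1 // => j' _.
by rewrite !ffunE !val_eqE (negPf ni) mul0r mul0rz.
Qed.

Lemma oct_basis0l (A : algType R) (x : octo A) : oct_tensor (oe 0) 1 *o x = x.
Proof.
apply/ffunP=> k; rewrite ffunE (bigD1 ord0) //= [X in _ + X]big1.
  rewrite addr0 (bigD1 k) //= [X in _ + X]big1 => [|j nj].
    by rewrite !ffunE eqxx scale1r mul1r addr0 /oct_coef /= eqxx.
  by rewrite /oct_coef /= val_eqE (negPf nj) mulr0z.
move=> i ni; rewrite big1 // => j _.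
by rewrite !ffunE -[0%N]/(val (@ord0 7)) val_eqE (negPf ni) scale0r mul0r mul0rz.
Qed.

Lemma oct_basis0r (x : octonion R) : x *o oe 0 = x.
Proof.
apply/ffunP=> k; rewrite ffunE (bigD1 k) //= [X in _ + X]big1 => [|i ni].
  rewrite addr0 (bigD1 ord0) //= [X in _ + X]big1 => [|j nj].
    rewrite addr0 !ffunE mulr1 /oct_coef /= eqxx.
    by case: eqP => [->|].
  by rewrite !ffunE -[0%N]/(val (@ord0 7)) val_eqE (negPf nj) mulr0 mul0rz.
rewrite (bigD1 ord0) //= [X in _ + X]big1 => [|j nj].
  have /negPf nik: i != k :> nat by rewrite val_eqE.
  rewrite addr0 /oct_coef /= nik; case: eqP => [i0|]; rewrite ?mulr0z //.
  have ->: (0 == k :> nat)%N = false by move: nik; rewrite i0.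
  by rewrite [LHS]mulr0z.
by rewrite !ffunE -[0%N]/(val (@ord0 7)) val_eqE (negPf nj) mulr0 mul0rz.
Qed.

Lemma tensorM (A : algType R) (a b : octonion R) (u v : A) :
  oct_tensor a u *o oct_tensor b v = oct_tensor (a *o b) (u * v).
Proof.
apply/ffunP=> k; rewrite !ffunE scaler_suml; apply: eq_bigr => i _.
rewrite scaler_suml; apply: eq_bigr => j _.
by rewrite !ffunE -scalerAl -scalerAr scalerA scalerMzl.
Qed.

Lemma tensor_expand (A : lmodType R) (x : octo A) :
  x = \sum_(k < 8) oct_tensor (oe k) (x k).
Proof.
apply/ffunP=> k; rewrite sum_ffunE (bigD1 k) //= big1 ?addr0.
  by rewrite !ffunE eqxx scale1r.
by move=> j njk; rewrite !ffunE !val_eqE eq_sym (negPf njk) scale0r.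
Qed.

Lemma tensor_ext (A V : lmodType R) (f g : {linear octo A -> V}) :
  (forall a u, f (oct_tensor a u) = g (oct_tensor a u)) -> f =1 g.
Proof.
by move=> fg x; rewrite [x]tensor_expand !linear_sum; apply: eq_bigr.
Qed.

Lemma tensor_universal (A V : lmodType R) (b : octonion R -> A -> V) :
    (forall u, linear (b^~ u)) -> (forall a, linear (b a)) ->
  exists f : {linear octo A -> V}, forall a u, f (oct_tensor a u) = b a u.
Proof.
move=> linl linr; pose f (x : octo A) := \sum_(k < 8) b (oe k) (x k).
have linf : linear f.
  move=> c x y; rewrite scaler_sumr -big_split; apply: eq_bigr => k _ /=.
  by rewrite !ffunE linr.
pose Lf := GRing.isLinear.Build R (octo A) V *:%R f linf.
exists (HB.pack f Lf : {linear octo A -> V}) => a u.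
pose Ll := GRing.isLinear.Build R (octonion R) V *:%R (b^~ u) (linl u).
pose bl : {linear octonion R -> V} := HB.pack (b^~ u) Ll.
rewrite -[RHS]/(bl a) [in RHS](oct_expand a) linear_sum.
apply: eq_bigr => k _; rewrite linearZ /= ffunE.
pose Lr := GRing.isLinear.Build R A V *:%R (b (oe k)) (linr (oe k)).
pose br : {linear A -> V} := HB.pack (b (oe k)) Lr.
by rewrite -[LHS]/(br _) linearZ.
Qed.

Lemma tensor_mapE (A : lmodType R) (f : {linear octonion R -> octonion R})
    (a : octonion R) (u : A) :
  tensor_map f (oct_tensor a u) = oct_tensor (f a) u.
Proof.
apply/ffunP=> k; rewrite sum_ffunE ffunE [in RHS](oct_expand a) linear_sum.
rewrite sum_ffunE scaler_suml; apply: eq_bigr => j _.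
by rewrite linearZ octZE !ffunE -[RHS]scalerA [RHS]scalerA mulrC -scalerA.
Qed.

Let oct_basis_table i j k (s : int) : (i < 8)%N -> (j < 8)%N ->
    (forall l, (l < 8)%N -> oct_coef i j l = if l == k then s else 0) ->
  (k < 8)%N -> oe i *o oe j = oe k *~ s.
Proof.
move=> lti ltj Dc ltk.
rewrite (oct_basisM (Ordinal lti) (Ordinal ltj)) (bigD1 (Ordinal ltk)) //=.
rewrite Dc // eqxx big1 ?addr0 // => l nl.
by rewrite Dc // -[k]/(val (Ordinal ltk)) val_eqE (negPf nl) mulr0z.
Qed.

Lemma oct_involution_unique i (J J' : {linear octonion R -> octonion R}) :
  oct_involution i J -> oct_involution i J' -> J =1 J'.
Proof.
move=> [aJ J1 J2 J4] [aJ' J'1 J'2 J'4] x; have [_ JM] := aJ; have [_ J'M] := aJ'.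
rewrite [x]oct_expand !linear_sum; apply: eq_bigr => k _; rewrite !linearZ.
have gen a b c : (a < 8)%N -> (b < 8)%N -> (c < 8)%N ->
    (forall l, (l < 8)%N -> oct_coef a b l = if l == c then 1 else 0) ->
    J (oe a) = J' (oe a) -> J (oe b) = J' (oe b) -> J (oe c) = J' (oe c).
  move=> lta ltb ltc Dc Ja Jb; rewrite -[oe c]mulr1z.
  by rewrite -(oct_basis_table lta ltb Dc ltc) JM J'M Ja Jb.
have E1 : J (oe 1) = J' (oe 1) by rewrite J1 J'1.
have E2 : J (oe 2) = J' (oe 2) by rewrite J2 J'2.
have E4 : J (oe 4) = J' (oe 4) by rewrite J4 J'4.
have E3 : J (oe 3) = J' (oe 3) by apply: (gen 1 2) => //; do 8?case=> //.
have E5 : J (oe 5) = J' (oe 5) by apply: (gen 1 4) => //; do 8?case=> //.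
have E6 : J (oe 6) = J' (oe 6) by apply: (gen 2 4) => //; do 8?case=> //.
have E7 : J (oe 7) = J' (oe 7) by apply: (gen 2 5) => //; do 8?case=> //.
have J0 (K : {linear octonion R -> octonion R}) :
    oct_automorphism K -> K (oe 0) = oe 0.
  case=> [[K' KK' K'K] KM].
  have un (y : octonion R) : oe 0 *o y = y.
    by rewrite -[RHS](@oct_basis0l R^o); congr (_ *o _); apply/ffunP=> l;
      rewrite !ffunE [RHS]mulr1.
  rewrite -[LHS]un -{1}[oe 0]K'K -KM oct_basis0r K'K //.
case: k => k ltk /=; congr (_ *: _).
by case: k ltk => [|[|[|[|[|[|[|[|k]]]]]]]] // _; rewrite !J0.
Qed.

Definition oct_character (i k : nat) : bool :=
  (odd i && odd k) (+) (odd (i %/ 2) && odd (k %/ 2))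
    (+) (odd (i %/ 4) && odd (k %/ 4)).

Let oct_characterM (i a b c : 'I_8) : oct_coef a b c != 0 ->
  oct_character i c = oct_character i a (+) oct_character i b.
Proof.
have: all (fun i => all (fun a => all (fun b => all (fun c =>
    (oct_coef a b c != 0) ==>
      (oct_character i c == oct_character i a (+) oct_character i b))
  (iota 0 8)) (iota 0 8)) (iota 0 8)) (iota 0 8) by vm_compute.
have in8 (x : 'I_8) : val x \in iota 0 8 by rewrite mem_iota /=.
move=> /allP/(_ _ (in8 i))/allP/(_ _ (in8 a))/allP/(_ _ (in8 b)).
by move=> /allP/(_ _ (in8 c))/implyP abc /abc/eqP.
Qed.

Lemma oct_involution_exists (i : 'I_8) :
  exists2 J : {linear octonion R -> octonion R}, oct_involution i J &
    forall j : 'I_8, exists s : bool,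
      J (oct_conj (oe j)) = (-1) ^+ s *: oe j.
Proof.
pose s (k : 'I_8) : R := (-1) ^+ oct_character i k.
pose f (x : octonion R) : octonion R := [ffun k => s k * x k].
have linf : linear f.
  move=> c x y; apply/ffunP=> k; rewrite !ffunE mulrDr; congr (_ + _).
  exact: (@mulrCA R (s k) c (x k)).
pose Lf := GRing.isLinear.Build R (octonion R) (octonion R) *:%R f linf.
pose J : {linear octonion R -> octonion R} := HB.pack f Lf.
have ss k : s k * s k = 1 by rewrite -expr2 sqrr_sign.
have fK : involutive f.
  by move=> x; apply/ffunP=> k; rewrite !ffunE mulrA ss mul1r.
have fe (k : 'I_8) : f (oe k) = s k *: oe k by apply/ffunP=> l;
  rewrite octZE !ffunE; case: eqP => [/val_inj-> //|_]; rewrite mulr0 [RHS]mulr0.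
have fen (n : nat) : (n < 8)%N -> f (oe n) = (-1) ^+ oct_character i n *: oe n.
  by move=> ltn; apply: (fe (Ordinal ltn)).
exists J; last first.
  move=> j; exists ((j != 0) (+) oct_character i j).
  have ->: oct_conj (oe j) = (-1) ^+ (j != 0) *: oe j.
    apply/ffunP=> k; rewrite octZE !ffunE.
    case: (eqVneq (k : nat) j) => [/val_inj-> | _]; last first.
      by rewrite oppr0 if_same [RHS]mulr0.
    by case: (j == 0); rewrite /= ?expr0 ?expr1 [RHS]mulr1.
  by rewrite linearZ /= fe scalerA signr_addb.
split; last 3 first.
- by rewrite [J _]fen // /oct_character /= !andbF !addbF andbT.
- by rewrite [J _]fen // /oct_character /= !andbF addbF andbT.
- by rewrite [J _]fen // /oct_character /= !andbF andbT.
split; first by exists f.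
move=> x y; apply/ffunP=> k; rewrite !ffunE mulr_sumr; apply: eq_bigr => a _.
rewrite mulr_sumr; apply: eq_bigr => b _; rewrite !ffunE.
have [-> | /(oct_characterM i) Dk] := eqVneq (oct_coef a b k) 0.
  by rewrite !mulr0z mulr0.
by rewrite [LHS](@mulrzAr R) {1}/s Dk signr_addb (@mulrACA R).
Qed.
End OctonionFacts.

(* Main.v *)
Require Import Defs.
From mathcomp Require Import all_boot all_order all_algebra.
From mathcomp Require Import reals.

Set Implicit Arguments.
Unset Strict Implicit.
Unset Printing Implicit Defensive.

Import GRing.Theory.
Local Open Scope ring_scope.

(** Since [Omega Phi(X) = \sum_k (conj e_k * Phi(X)) g_k] and
    [<conj e_k * x, e_j> = <x, e_k e_j> = <x * conj e_j, e_k>], expanding the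
    octonions [conj e_k * Phi(X)] in the basis gives
    [Omega Phi(X) = \sum_j e_j X_j]; applying [J_i] is the second formula.
    Each [e_k] is an eigenvector of [J_j], with eigenvalue
    [(-1) ^ oct_character j k], a character of [(Z/2)^3] in [j].
    Orthogonality of these characters inverts the second formula. *)

(** * Bilinearity of the product and of pure tensors; the adjoint identity *)

Section OctonionBilinearity.
Variables (R : comNzRingType).
Local Notation oe := (oct_basis R).

Lemma oct_mul_suml (A : pzRingType) (I : finType) (x : I -> octo A)
    (y : octo A) : (\sum_i x i) *o y = \sum_i x i *o y.
Proof.
apply/ffunP=> k; rewrite sum_ffunE ffunE.
under [RHS]eq_bigr => n _ do rewrite ffunE.
rewrite [RHS]exchange_big; apply: eq_bigr => a _ /=.
rewrite [RHS]exchange_big; apply: eq_bigr => b _ /=.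
by rewrite sum_ffunE mulr_suml mulrz_suml.
Qed.

Lemma oct_mul_sumr (A : pzRingType) (I : finType) (x : octo A)
    (y : I -> octo A) : x *o (\sum_i y i) = \sum_i x *o y i.
Proof.
apply/ffunP=> k; rewrite sum_ffunE ffunE.
under [RHS]eq_bigr => n _ do rewrite ffunE.
rewrite [RHS]exchange_big; apply: eq_bigr => a _ /=.
rewrite [RHS]exchange_big; apply: eq_bigr => b _ /=.
by rewrite sum_ffunE mulr_sumr mulrz_suml.
Qed.

Lemma oct_mulZl (A : algType R) c (x y : octo A) :
  (c *: x) *o y = c *: (x *o y).
Proof.
apply/ffunP=> k; rewrite octZE !ffunE scaler_sumr; apply: eq_bigr => a _.
rewrite scaler_sumr; apply: eq_bigr => b _.
by rewrite octZE -scalerAl scalerMzr.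
Qed.

Lemma oct_mulZr (A : algType R) c (x y : octo A) :
  x *o (c *: y) = c *: (x *o y).
Proof.
apply/ffunP=> k; rewrite octZE !ffunE scaler_sumr; apply: eq_bigr => a _.
rewrite scaler_sumr; apply: eq_bigr => b _.
by rewrite octZE -scalerAr scalerMzr.
Qed.

Lemma oct_tensor_suml (A : lmodType R) (I : finType) (a : I -> octonion R)
    (u : A) : oct_tensor (\sum_i a i) u = \sum_i oct_tensor (a i) u.
Proof.
apply/ffunP=> k; rewrite !(sum_ffunE, ffunE) scaler_suml.
by apply: eq_bigr => i _; rewrite ffunE.
Qed.

Lemma oct_tensor_sumr (A : lmodType R) (I : finType) (a : octonion R)
    (u : I -> A) : oct_tensor a (\sum_i u i) = \sum_i oct_tensor a (u i).
Proof.
apply/ffunP=> k; rewrite !(sum_ffunE, ffunE) scaler_sumr.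
by apply: eq_bigr => i _; rewrite ffunE.
Qed.

Lemma oct_tensorZl (A : lmodType R) c (a : octonion R) (u : A) :
  oct_tensor (c *: a) u = c *: oct_tensor a u.
Proof. by apply/ffunP=> k; rewrite octZE !ffunE scalerA. Qed.

Lemma oct_tensorZr (A : lmodType R) c (a : octonion R) (u : A) :
  oct_tensor a (c *: u) = c *: oct_tensor a u.
Proof. by apply/ffunP=> k; rewrite octZE !ffunE !scalerA mulrC. Qed.

Lemma tensor_map_sum (A : lmodType R) (I : finType)
    (f : octonion R -> octonion R) (x : I -> octo A) :
  tensor_map f (\sum_i x i) = \sum_i tensor_map f (x i).
Proof.
rewrite exchange_big; apply: eq_bigr => k _ /=.
by rewrite sum_ffunE oct_tensor_sumr.
Qed.

Lemma oct_in_cl8_in (a : octonion R) (u : clifford R 8) :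
  oct_in a *o cl8_in u = oct_tensor a u.
Proof. by rewrite /oct_in /cl8_in tensorM oct_basis0r mul1r. Qed.

Lemma oct_conj_basis (i : 'I_8) :
  oct_conj (oe i) = (-1) ^+ (i != 0) *: oe i.
Proof.
apply/ffunP=> k; rewrite octZE !ffunE.
case: (eqVneq (k : nat) i) => [/val_inj-> | _]; last first.
  by rewrite oppr0 if_same [RHS]mulr0.
by case: (i == 0); rewrite /= ?expr0 ?expr1 [RHS]mulr1.
Qed.

Lemma oct_basis_mulE (i k : 'I_8) (x : octonion R) :
  (oe i *o x) k = \sum_(j < 8) x j *~ oct_coef i j k.
Proof.
rewrite ffunE (bigD1 i) //= [X in _ + X]big1 => [|j ji].
  by rewrite addr0; apply: eq_bigr => j _; rewrite ffunE eqxx mul1r.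
rewrite big1 // => l _.
by rewrite !ffunE !val_eqE (negPf ji) mul0r mul0rz.
Qed.

Lemma oct_mul_basisE (i k : 'I_8) (x : octonion R) :
  (x *o oe i) k = \sum_(j < 8) x j *~ oct_coef j i k.
Proof.
rewrite ffunE; apply: eq_bigr => j _.
rewrite (bigD1 i) //= [X in _ + X]big1 => [|l li].
  by rewrite addr0 ffunE eqxx mulr1.
by rewrite !ffunE !val_eqE (negPf li) mulr0 mul0rz.
Qed.

Lemma mem_iota_ord n (i : 'I_n) : val i \in iota 0 n.
Proof. by rewrite mem_iota /=. Qed.

(** For basis elements, both sides are the inner product of [e_j] with [e_i e_k]: left
    multiplication by [conj e_i] is adjoint to that by [e_i], and right multiplication by [conj e_k]
    to that by [e_k]. The 512 cases are checked by computation in [int]. *)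
Lemma oct_coef_adjoint (i j k : 'I_8) :
  (-1) ^+ (i != 0) * oct_coef i j k = (-1) ^+ (k != 0) * oct_coef j k i.
Proof.
have: all (fun i => all (fun j => all (fun k =>
    (-1) ^+ (i != 0)%N * oct_coef i j k ==
      (-1) ^+ (k != 0)%N * oct_coef j k i)
  (iota 0 8)) (iota 0 8)) (iota 0 8) by vm_compute.
move=> /allP/(_ _ (mem_iota_ord i))/allP/(_ _ (mem_iota_ord j)).
by move=> /allP/(_ _ (mem_iota_ord k))/eqP.
Qed.

(* Both sides are the inner product of [x] with [e_i e_j]. *)
Lemma oct_conj_adjoint (i j : 'I_8) (x : octonion R) :
  (oct_conj (oe i) *o x) j = (x *o oct_conj (oe j)) i.
Proof.
have scale_coef (b : bool) (y : R) z : (-1) ^+ b * (y *~ z) = y *~ ((-1) ^+ b * z).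
  by case: b => /=; rewrite !(expr0, expr1, mul1r, mulN1r, mulrNz).
rewrite !oct_conj_basis (@oct_mulZl R^o) (@oct_mulZr R^o) !octZE.
rewrite oct_basis_mulE oct_mul_basisE !scaler_sumr.
apply: eq_bigr => k _; transitivity (x k *~ ((-1) ^+ (i != 0) * oct_coef i k j)).
  exact: scale_coef.
rewrite oct_coef_adjoint; exact/esym/scale_coef.
Qed.
End OctonionBilinearity.

(** * Hermitian variables in terms of twistor vectors *)

Section HermitianVariables.
Variables (R : comNzRingType).
Local Notation oe := (oct_basis R).

(** The second formula in terms of pure tensors, which also serves as the input to the inversion.
    The two sides are compared at each [g_k]. *)
Lemma hermitian_var_tensor (J : {linear octonion R -> octonion R}) X :
    (forall x y, J (x *o y) = J x *o J y) ->
  hermitian_var J X =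
    \sum_(j < 8) oct_tensor (J (oe j)) (cl8_vector (twistor X j)).
Proof.
move=> JM; rewrite /hermitian_var /witt_basis /oct_Omega.
rewrite tensor_map_sum oct_mul_suml.
under [RHS]eq_bigr => j _ do rewrite oct_tensor_sumr.
rewrite exchange_big; apply: eq_bigr => k _ /=.
(* Multiplicativity merges [J (conj e_k)] and [J (Phi X)] into [J (conj e_k * Phi X)]. *)
rewrite tensor_mapE /oct_in tensorM mulr1 -JM.
rewrite [oct_conj _ *o _]oct_expand linear_sum oct_tensor_suml.
apply: eq_bigr => j _.
(* The [k]-th coordinate of [X_j] is that of [Phi X * conj e_j], hence the [j]-th coordinate of
   [conj e_k * Phi X]. *)
by rewrite linearZ oct_tensorZl oct_tensorZr mxE oct_conj_adjoint.
Qed.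

(** * Eigenvalues of the involutions and their orthogonality *)

Lemma oct_basis_table (i j k : 'I_8) :
    all (fun l => oct_coef i j l == (l == k)%:R) (iota 0 8) ->
  oe i *o oe j = oe k.
Proof.
move=> /allP tab; rewrite oct_basisM (bigD1 k) //=.
rewrite (eqP (tab _ (mem_iota_ord k))) eqxx big1 ?addr0 // => l lk.
by rewrite (eqP (tab _ (mem_iota_ord l))) val_eqE (negPf lk) mulr0z.
Qed.

Lemma oct_basis_sqr (i : 'I_8) : oe i *o oe i = (-1) ^+ (i != 0) *: oe 0.
Proof.
rewrite oct_basisM (bigD1 ord0) //= big1 => [|k].
  rewrite addr0 -scaler_int; congr (_ *: _).
  by rewrite /oct_coef eqxx -val_eqE /=; case: eqP.
rewrite -val_eqE /oct_coef eqxx => /negPf /= k0.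
by case: eqP => [->|_]; rewrite ?[(0 == k :> nat)%N]eq_sym k0 ?oppr0 mulr0z.
Qed.

(** By surjectivity [e_0 = J a] for some [a], so [J e_0 = J a * J e_0 = J (a * e_0) = e_0]. *)
Lemma oct_automorphism1 (J : {linear octonion R -> octonion R}) :
  oct_automorphism J -> J (oe 0) = oe 0.
Proof.
case=> [[J' _ J'K] JM].
have mul1o (y : octonion R) : oe 0 *o y = y.
  by rewrite -[RHS](@oct_basis0l R R^o); congr (_ *o _); apply/ffunP=> l;
    rewrite !ffunE [RHS]mulr1.
by rewrite -[LHS]mul1o -{1}[oe 0]J'K -JM oct_basis0r J'K.
Qed.

(** Eigenvalues multiply along products, so the generators [e_1], [e_2], [e_4] yield
    [e_3 = e_1 e_2], [e_5 = e_1 e_4], [e_6 = e_2 e_4] and [e_7 = e_3 e_4]; the character is additive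
    along these four products. *)
Lemma oct_involution_basis (j k : 'I_8)
    (J : {linear octonion R -> octonion R}) : oct_involution j J ->
  J (oe k) = (-1) ^+ oct_character j k *: oe k.
Proof.
move=> [aJ J1 J2 J4]; have [_ JM] := aJ.
pose eigen k := J (oe k) = (-1) ^+ oct_character j k *: oe k.
have gen a b c (lta : (a < 8)%N) (ltb : (b < 8)%N) (ltc : (c < 8)%N) :
    all (fun l => oct_coef a b l == (l == c)%:R) (iota 0 8) ->
    oct_character j c = oct_character j a (+) oct_character j b ->
    eigen a -> eigen b -> eigen c.
  move=> tab chi Ja Jb; have E := @oct_basis_table
    (Ordinal lta) (Ordinal ltb) (Ordinal ltc) tab.
  rewrite /eigen -[oe c]E JM Ja Jb (@oct_mulZl _ R^o) (@oct_mulZr _ R^o).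
  by rewrite scalerA -signr_addb -chi.
have chi : all (fun j => all (fun t => let: (a, b, c) := t in
    oct_character j c == oct_character j a (+) oct_character j b)
    [:: (1, 2, 3); (1, 4, 5); (2, 4, 6); (3, 4, 7)]%N) (iota 0 8).
  by vm_compute.
have {chi} /and5P[/eqP c3 /eqP c5 /eqP c6 /eqP c7 _] :=
  allP chi _ (mem_iota_ord j).
have E0 : eigen 0%N.
  by rewrite /eigen oct_automorphism1 // /oct_character /= !andbF scale1r.
have E1 : eigen 1%N by rewrite /eigen J1 /oct_character /= !andbF !addbF andbT.
have E2 : eigen 2%N by rewrite /eigen J2 /oct_character /= !andbF addbF andbT.
have E4 : eigen 4%N by rewrite /eigen J4 /oct_character /= !andbF andbT.
have E3 : eigen 3%N by apply: (gen 1 2)%N.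
have E5 : eigen 5%N by apply: (gen 1 4)%N.
have E6 : eigen 6%N by apply: (gen 2 4)%N.
have E7 : eigen 7%N by apply: (gen 3 4)%N.
by case: k; do 8?case=> //.
Qed.

Lemma oct_character_orthogonal (i k : 'I_8) :
  \sum_(j < 8) (-1) ^+ oct_character j i * (-1) ^+ oct_character j k =
    if i == k then 8 else 0 :> R.
Proof.
have: all (fun i => all (fun k =>
    foldr +%R 0 [seq (-1) ^+ (oct_character j i (+) oct_character j k)
      | j <- iota 0 8] == (if i == k then 8 else 0) :> int)
  (iota 0 8)) (iota 0 8) by vm_compute.
move=> /allP/(_ _ (mem_iota_ord i))/allP/(_ _ (mem_iota_ord k))/eqP E.
(* The sums have been evaluated over [int]; the ring morphism to [R] transports them. *)
transitivity ((if i == k then 8 else 0 : int)%:~R : R); last by case: eqP.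
rewrite -val_eqE -E foldrE big_map -[iota 0 8]/(index_iota 0 8) big_mkord.
rewrite rmorph_sum; apply: eq_bigr => j _ /=.
by rewrite -signr_addb rmorph_sign.
Qed.
End HermitianVariables.

Theorem theorem4p10 (R : realType)
    (J : 'I_8 -> {linear octonion R -> octonion R})
    (hJ : forall i : 'I_8, oct_involution i (J i))
    (sigma : 'I_8 -> 'I_8 -> bool)
    (hsigma : forall j i : 'I_8,
      J j (oct_conj (oct_basis R i)) = (-1) ^+ sigma j i *: oct_basis R i)
    (X : 'rV[R]_8) (i : 'I_8) :
  cl8_in (cl8_vector (twistor X i)) =
    8^-1 *: (oct_in (oct_basis R i) *o
             \sum_(j < 8) (-1) ^+ sigma j i *: hermitian_var (J j) X) /\
  hermitian_var (J i) X =
    \sum_(j < 8) oct_in (J i (oct_basis R j)) *o cl8_in (cl8_vector (twistor X j)).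
Proof.
have JM j : forall x y, J j (x *o y) = J j x *o J j y by case: (hJ j) => -[].
have Je j k := oct_involution_basis k (hJ j).
split; last first.
  rewrite hermitian_var_tensor //.
  by apply: eq_bigr => j _; rewrite oct_in_cl8_in.
(* The [i]-th coordinate of [hsigma j i] fixes the sign: conjugation contributes the first factor,
   [J j] the second. *)
have sign_sigma j :
    (-1) ^+ sigma j i = (-1) ^+ (i != 0) * (-1) ^+ oct_character j i :> R.
  have /ffunP/(_ i) := hsigma j i.
  rewrite oct_conj_basis linearZ /= Je !octZE ffunE eqxx.
  by rewrite [X in _ = X -> _]mulr1 => <-; congr (_ * _); apply: mulr1.
have -> : \sum_(j < 8) (-1) ^+ sigma j i *: hermitian_var (J j) X =
    (8 * (-1) ^+ (i != 0)) *: oct_tensor (oct_basis R i)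
      (cl8_vector (twistor X i)).
  under eq_bigr => j _ do rewrite hermitian_var_tensor // scaler_sumr.
  (* After the exchange, the term of [X_k] carries the character sum for [i] and [k], so only
     [k = i] survives, with weight 8. *)
  rewrite exchange_big (bigD1 i) //= [X in _ + X]big1 => [|k ki].
    under eq_bigr => j _ do
      rewrite Je oct_tensorZl scalerA sign_sigma -mulrA.
    rewrite addr0 -scaler_suml -mulr_sumr oct_character_orthogonal eqxx.
    by rewrite mulrC.
  under eq_bigr => j _ do
    rewrite Je oct_tensorZl scalerA sign_sigma -mulrA.
  rewrite -scaler_suml -mulr_sumr oct_character_orthogonal [i == k]eq_sym (negPf ki).
  by rewrite mulr0 scale0r.
(* Left multiplication by [e_i] turns [e_i] into [e_i e_i], whose sign cancels the one from
   conjugation. *)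
rewrite oct_mulZr tensorM mul1r oct_basis_sqr oct_tensorZl !scalerA.
rewrite mulrA mulVf ?Num.Theory.pnatr_eq0 // mul1r -expr2 sqrr_sign.
by rewrite scale1r.
Qed.
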